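(* Let $(\Omega,\Sigma,\mu)$ be a finite and positive measure space, let $(\mathcal{X},\|\cdot\|)$ be a separable Banach space, and let $r>0$. Assume $p_*>1$ and $\varepsilon\in(0,\sigma_* )$. Then for every $p\in(p_*-\delta^*(\varepsilon),p_*+\delta^*(\varepsilon))$ the inclusion $$B_{\Omega,\mathcal{X},p}(r)\subset B_{\Omega,\mathcal{X},p_*}(r)+\varepsilon B_{\Omega,\mathcal{X},1}(1)$$ holds, where $\sigma_*>0$ and $\delta^*(\varepsilon)\in\left(0,\frac{p_*-1}{2}\right]$ are the numbers given in the context.
   Context: For $p\ge 1$, $L_p(\Omega,\Sigma,\mu;\mathcal{X})$ is the Bochner space of (equivalence classes of) $\mu$-measurable functions $x:\Omega\to\mathcal{X}$ with $\|x\|_p=\left(\int_\Omega\|x(s)\|^p\mu(ds)\right)^{1/p}<+\infty$, and for $\rho>0$, $B_{\Omega,\mathcal{X},p}(\rho)=\{x\in L_p(\Omega,\Sigma,\mu;\mathcal{X}):\|x\|_p\le \rho\}$. Since $\mu$ is finite, $L_p\subset L_1$; sums of sets are Minkowski sums in $L_1$. For fixed $p_*>1$ and $\varepsilon>0$ put $$c_*=\max\left\{\max\left\{r^{\frac{p-p_*}{p}}:p\in[p_*,2p_*]\right\},\ \max\left\{r^{\frac{p_*-p}{p_*}}:p\in\left[\tfrac{p_*+1}{2},p_*\right]\right\}\right\},$$ $$d_*=(\mu(\Omega)+1)(c_*+1),\qquad \alpha_*(\varepsilon)=\max\left\{2r,\ r\left(\tfrac{8r}{\varepsilon}\right)^{\frac{2}{p_*-1}}\right\},$$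 $$\sigma_*=\min\left\{\tfrac r2,\ 4d_*,\ 4r\mu(\Omega),\ 4d_*\sqrt r\right\}.$$ For $\varepsilon\in(0,\sigma_* )$ put $\alpha_1=2\alpha_*(\varepsilon)$, $\alpha_2=3\alpha_*(\varepsilon)$, $\kappa=\frac{\varepsilon}{4\alpha_1\mu(\Omega)}$, $b=\frac{\varepsilon}{4r\mu(\Omega)}$, $h=\frac{64rd_*^2}{\varepsilon^2}$, and $$\delta_3(\varepsilon)=\min\left\{p_*\log_{r/\alpha_1}(1-\kappa),\ p_*\log_{h}(1+\kappa),\ \tfrac{p_*-1}{2}\right\},$$ $$\delta_4(\varepsilon)=\min\left\{p_*\log_{\alpha_1/r}(\alpha_2/\alpha_1),\ p_*\log_{b}(1-\kappa),\ p_*\log_{\alpha_1/r}(1+\kappa),\ p_*\right\},$$ $$\delta^*(\varepsilon)=\min\{\delta_3(\varepsilon),\delta_4(\varepsilon)\}.$$ *)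

(* Defs.v *)
From HB Require Import structures.
From mathcomp Require Import all_boot all_order all_algebra.
From mathcomp Require Import all_classical all_reals all_analysis.
From mathcomp Require Import measurable_realfun.

Set Implicit Arguments.
Unset Strict Implicit.
Unset Printing Implicit Defensive.

Import Order.TTheory GRing.Theory Num.Theory.
Import numFieldNormedType.Exports.

Local Open Scope classical_set_scope.
Local Open Scope ring_scope.

Definition separable_space (X : topologicalType) : Prop :=
  exists2 D : set X, countable D & dense D.

Section mu_measurable.
Context d (T : measurableType d) (R : realType) (X : normedModType R).
Variable mu : {measure set T -> \bar R}.

Definition simple_fun (s : T -> X) : Prop :=
  finite_set (range s) /\ forall c : X, measurable (s @^-1` [set c]).

(* Strong measurability in the sense of Bochner. As the limit is only taken
   almost everywhere and mu need not be complete, preimages of Borel sets under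
   x are measurable only up to negligible sets. *)
Definition mu_measurable (x : T -> X) : Prop :=
  exists2 s : nat -> T -> X, (forall n, simple_fun (s n)) &
    {ae mu, forall t, s ^~ t @ \oo --> x t}.

Lemma simple_fun_cst c : simple_fun (cst c).
Proof.
split; first by apply: (sub_finite_set _ (finite_set1 c)) => _ [t _ <-].
move=> c'; rewrite preimage_cst; case: ifP => _; [exact: measurableT|exact: measurable0].
Qed.

Lemma simple_fun_comp2 (g : X -> X -> X) (s1 s2 : T -> X) :
  simple_fun s1 -> simple_fun s2 -> simple_fun (fun t => g (s1 t) (s2 t)).
Proof.
move=> [fs1 ms1] [fs2 ms2]; split.
  apply: (sub_finite_set _ (finite_image2 g fs1 fs2)).
  by move=> _ [t _ <-]; exists (s1 t); [exists t|exists (s2 t); [exists t|]].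
move=> c.
rewrite [X in measurable X](_ : _ =
  \bigcup_(ab in [set ab | (range s1 `*` range s2) ab /\ g ab.1 ab.2 = c])
    (s1 @^-1` [set ab.1] `&` s2 @^-1` [set ab.2])); last first.
  apply/seteqP; split => [t /= <-|t [[a b] /= [_ <-] [-> ->]] //].
  by exists (s1 t, s2 t) => //=; split => //; split; exists t.
apply: fin_bigcup_measurable => [|ab _]; last exact: measurableI.
by apply: (sub_finite_set _ (finite_setX fs1 fs2)) => ab [].
Qed.

Definition mu_meas : {pred T -> X} := mem [set x | mu_measurable x].

Lemma mu_meas_submod_closed : submod_closed mu_meas.
Proof.
split.
  rewrite inE; exists (fun=> cst 0) => [n|]; first exact: simple_fun_cst.
  by apply: aeW => t; exact: cvg_cst.
move=> a x y; rewrite !inE => -[s ss sx] [s' ss' sy].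
exists (fun n t => a *: s n t + s' n t) => [n|].
  exact: (simple_fun_comp2 (fun u v => a *: u + v) (ss n) (ss' n)).
by apply: filterS2 sx sy => t xt yt; apply: cvgD => //; exact: cvgZl_tmp.
Qed.

HB.instance Definition _ :=
  GRing.isSubmodClosed.Build R (T -> X) mu_meas mu_meas_submod_closed.

Record mmfun := MMFun { mmfun_val :> T -> X; _ : mmfun_val \in mu_meas }.

HB.instance Definition _ := [isSub for mmfun_val].
HB.instance Definition _ := [Choice of mmfun by <:].
HB.instance Definition _ := [SubChoice_isSubLmodule of mmfun by <:].

End mu_measurable.

Section ae_integral.
Context d (T : measurableType d) (R : realType).
Variable mu : {measure set T -> \bar R}.
Local Open Scope ereal_scope.
Import HBNNSimple.

Let le_integral_ae (f g : T -> \bar R) : (forall t, 0 <= f t) ->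
  (forall t, 0 <= g t) -> f = g %[ae mu] ->
  \int[mu]_t f t <= \int[mu]_t g t.
Proof.
move=> f0 g0 [N [mN muN0 subN]].
rewrite [leLHS]ge0_integralTE//; apply: ge_ereal_sup => _ [h /= hf <-].
have h0 t : 0 <= (h t)%:E by rewrite lee_fin.
have mh : measurable_fun setT (fun t => (h t)%:E) by exact/measurable_EFinP.
have mN' := measurableC mN.
have -> : sintegral mu h = sintegral mu (proj_nnsfun h mN').
  rewrite -2!integralT_nnsfun (ge0_negligible_integral mN)// setTD.
  rewrite integral_mkcond; apply: eq_integral => t _ /=.
  by rewrite patchE mindicE; case: ifPn; rewrite ?mulr1 ?mulr0.
rewrite ge0_integralTE//; apply: ereal_sup_ubound => /=.
exists (proj_nnsfun h mN') => //= t; rewrite mindicE.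
have [|_] := boolP (t \in ~` N); last by rewrite mulr0; exact: g0.
rewrite inE mulr1 => tN; rewrite (le_trans (hf t))// le_eqVlt.
apply/orP; left; apply/eqP; apply: contrapT => fg; apply: tN.
by apply: subN => /= /(_ I).
Qed.

(* No measurability is required, unlike in ge0_ae_eq_integral: the library's
   integral of a nonnegative function is a supremum over simple functions below
   it. It thus agrees with the integral of any measurable function that is
   almost everywhere equal to the integrand. *)
Lemma ge0_ae_eq_integral_nm (f g : T -> \bar R) : (forall t, 0 <= f t) ->
  (forall t, 0 <= g t) -> f = g %[ae mu] ->
  \int[mu]_t f t = \int[mu]_t g t.
Proof.
move=> f0 g0 fg; apply/eqP; rewrite eq_le !le_integral_ae//.
exact: ae_eq_sym.
Qed.

End ae_integral.

Section Bochner.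
Context d (T : measurableType d) (R : realType) (X : normedModType R).
Variable mu : {measure set T -> \bar R}.

Definition ae0 : {pred mmfun X mu} :=
  mem [set x : mmfun X mu | (x : T -> X) = 0 %[ae mu]].

Lemma ae0_zmod_closed : zmod_closed ae0.
Proof.
split; first by rewrite inE; exact: aeW.
move=> x y; rewrite !inE /=; apply: filterS2 => t x0 y0 /= _.
by rewrite [_ t](_ : _ = x t - y t)// x0// y0// subrr.
Qed.

HB.instance Definition _ :=
  GRing.isZmodClosed.Build (mmfun X mu) ae0 ae0_zmod_closed.

(* The classes modulo almost-everywhere equality of all the mu-measurable
   functions. This vector space contains every L_p, 1 <= p, so that sums of
   subsets of L_1 can be taken here. *)
Definition L0 : Type := Quotient.quot ae0.
HB.instance Definition _ := GRing.Zmodule.on L0.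
HB.instance Definition _ := EqQuotient.on L0.

Local Open Scope quotient_scope.

Lemma L0_eqP (x y : mmfun X mu) :
  \pi_L0 x = \pi_L0 y <-> (x : T -> X) = y %[ae mu].
Proof.
rewrite (rwP eqP) -Quotient.idealrBE inE /=.
split; apply: filterS => t /= xy _; have {xy} := xy I.
  by move/eqP; rewrite subr_eq0 => /eqP.
by move=> xyt; rewrite -[LHS]/(x t - y t) xyt subrr.
Qed.

Definition L0_scale (a : R) := lift_op1 L0 ( *:%R a).

Let L0_piZ_subproof a (x : mmfun X mu) : L0_scale a (\pi_L0 x) = \pi_L0 (a *: x).
Proof.
unlock L0_scale; apply/L0_eqP; have /L0_eqP := reprK (\pi_L0 x).
by apply: filterS => t /= xt _; rewrite -[LHS]/(a *: _) xt.
Qed.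

Lemma L0_piD (x y : mmfun X mu) :
  \pi_L0 x + \pi_L0 y = \pi_L0 (x + y).
Proof. exact/esym/(@Quotient.pi_add _ ae0). Qed.

Let L0_scaleA a b x : L0_scale a (L0_scale b x) = L0_scale (a * b) x.
Proof. by rewrite -[x]reprK !L0_piZ_subproof scalerA. Qed.

Let L0_scale1 : left_id 1 L0_scale.
Proof. by move=> x; rewrite -[x]reprK L0_piZ_subproof scale1r. Qed.

Let L0_scaleDr : right_distributive L0_scale +%R.
Proof.
move=> a x y; rewrite -[x]reprK -[y]reprK.
by rewrite L0_piD !L0_piZ_subproof L0_piD scalerDr.
Qed.

Let L0_scaleDl x : {morph L0_scale^~ x : a b / a + b}.
Proof.
by move=> a b; rewrite -[x]reprK !L0_piZ_subproof L0_piD scalerDl.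
Qed.

HB.instance Definition _ := GRing.Zmodule_isLmodule.Build R L0
  L0_scaleA L0_scale1 L0_scaleDr L0_scaleDl.

Lemma L0_piZ a (x : mmfun X mu) : a *: \pi_L0 x = \pi_L0 (a *: x).
Proof. exact: L0_piZ_subproof. Qed.

(* Independent of the chosen representative by Bochner_norm_pi. *)
Definition Bochner_norm (p : R) (x : L0) : \bar R :=
  'N[mu]_(p%:E)[EFin \o (fun t => `|(repr x : mmfun X mu) t|%R)]%E.

Lemma Bochner_norm_pi p (x : mmfun X mu) :
  Bochner_norm p (\pi_L0 x) = 'N[mu]_(p%:E)[EFin \o (fun t => `|x t|%R)]%E.
Proof.
rewrite /Bochner_norm unlock; congr (_ `^ _)%E.
apply: ge0_ae_eq_integral_nm => [t|t|]; [exact: poweR_ge0|exact: poweR_ge0|].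
have /L0_eqP := reprK (\pi_L0 x).
by apply: filterS => t /= xt /xt ->.
Qed.

Definition Bochner (p : R) : set L0 := [set x | (Bochner_norm p x < +oo)%E].

Definition Bochner_ball (p rho : R) : set L0 :=
  [set x | Bochner p x /\ (Bochner_norm p x <= rho%:E)%E].

End Bochner.
Arguments L0 {d T R} X mu.
Arguments Bochner_ball {d T R} X mu p rho.

Section constants.
Context (R : realType).
Implicit Types f : R -> R.

(* The supremum is attained when f is continuous, see max_onP. *)
Definition max_on f (a b : R) : R := sup [set f p | p in `[a, b]].

Lemma max_onP f a b : a <= b -> {within `[a, b], continuous f} ->
  (exists2 p, p \in `[a, b] & f p = max_on f a b) /\
  (forall p, p \in `[a, b] -> f p <= max_on f a b).
Proof.
move=> ab cf; have [c cab fc] := EVT_max ab cf.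
suff -> : max_on f a b = f c by split; [exists c|].
apply/eqP; rewrite eq_le; apply/andP; split.
  by apply: ge_sup => [|_ [p pab <-]]; [exists (f c), c|exact: fc].
by apply: ub_le_sup; [exists (f c) => _ [p pab <-]; exact: fc|exists c].
Qed.

Definition logb (b x : R) : R := ln x / ln b.

(* m is the total mass of the measure, ps the exponent p_*. *)
Variables (m r ps : R).

Definition c_star : R :=
  Num.max (max_on (fun p => r `^ ((p - ps) / p)) ps (2 * ps))
          (max_on (fun p => r `^ ((ps - p) / ps)) ((ps + 1) / 2) ps).

Definition d_star : R := (m + 1) * (c_star + 1).

Definition sigma_star : R :=
  Num.min (r / 2) (Num.min (4 * d_star)
    (Num.min (4 * r * m) (4 * d_star * Num.sqrt r))).

Variable eps : R.

Definition alpha_star : R :=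
  Num.max (2 * r) (r * (8 * r / eps) `^ (2 / (ps - 1))).

Definition alpha1 : R := 2 * alpha_star.
Definition alpha2 : R := 3 * alpha_star.
Definition kappa : R := eps / (4 * alpha1 * m).
Definition b_thr : R := eps / (4 * r * m).
Definition h_thr : R := 64 * r * d_star ^+ 2 / eps ^+ 2.

Definition delta3 : R :=
  Num.min (ps * logb (r / alpha1) (1 - kappa))
    (Num.min (ps * logb h_thr (1 + kappa)) ((ps - 1) / 2)).

Definition delta4 : R :=
  Num.min (ps * logb (alpha1 / r) (alpha2 / alpha1))
    (Num.min (ps * logb b_thr (1 - kappa))
      (Num.min (ps * logb (alpha1 / r) (1 + kappa)) ps)).

Definition delta_star : R := Num.min delta3 delta4.

End constants.

(* Main.v *)
(* The radial rescaling y = (|x| / r)^(p/p_* - 1) x satisfies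
   |y|^{p_*} = r^{p_* - p} |x|^p pointwise, so it maps the r-ball of L_p into the
   r-ball of L_{p_*}. The error |x - y| depends on t = |x| only: it is small when t
   is near 0, it is small for intermediate t because the rescaling factor is then
   within kappa of 1, and for t > alpha1 it is dominated by a small multiple of
   (t / r)^p, whose integral is at most 1. *)

Require Import Defs.
From mathcomp Require Import all_boot all_order all_algebra.
From mathcomp Require Import all_classical all_reals all_analysis.
From mathcomp Require Import measurable_realfun.
From mathcomp Require Import ring lra.
Import Order.TTheory GRing.Theory Num.Theory.
Import numFieldNormedType.Exports.
Local Open Scope classical_set_scope.
Local Open Scope ring_scope.

(** * Logarithmic bounds and positivity of the constants *)

Lemma powR_le_of_le_logb (R : realType) (a x th : R) :
  1 < a -> 0 < x -> th <= logb a x -> a `^ th <= x.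
Proof.
move=> a1 x0; have a0 : 0 < a := lt_trans ltr01 a1.
rewrite /logb ler_pdivlMr ?ln_gt0// -ln_powR ler_ln// posrE.
exact: powR_gt0.
Qed.

Lemma powR_ge_of_le_logb (R : realType) (a x th : R) :
  0 < a < 1 -> 0 < x -> th <= logb a x -> x <= a `^ th.
Proof.
move=> a01 x0; have /andP[a0 a1] := a01.
rewrite /logb ler_ndivlMr ?ln_lt0// -ln_powR ler_ln// posrE.
exact: powR_gt0.
Qed.

Lemma logb_gt0 (R : realType) (a x : R) : 1 < a -> 1 < x -> 0 < logb a x.
Proof. by move=> a1 x1; rewrite divr_gt0 ?ln_gt0. Qed.

Lemma logb_gt0_lt1 (R : realType) (a x : R) :
  0 < a < 1 -> 0 < x < 1 -> 0 < logb a x.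
Proof. by move=> a1 x1; rewrite /logb nmulr_rgt0 ?invr_lt0 ln_lt0. Qed.

Lemma le_c_star (R : realType) (r ps p : R) : 0 < r -> 1 < ps ->
  (ps + 1) / 2 <= p <= ps -> r `^ ((ps - p) / ps) <= c_star r ps.
Proof.
move=> r0 ps1 /andP[pl pu]; rewrite /c_star le_max; apply/orP; right.
apply: ub_le_sup; last by exists p => //=; rewrite in_itv/= pl.
(* The set is bounded: the exponent lies in [0, 1], so the power is at most r when r >= 1 and at
   most 1 otherwise. *)
exists (Num.max 1 r) => _ [q /= + <-]; rewrite in_itv/= => /andP[ql qu].
have q0 : 0 <= (ps - q) / ps by rewrite divr_ge0//; lra.
have q1 : (ps - q) / ps <= 1 by rewrite ler_pdivrMr; lra.
rewrite le_max; have [r1|r1] := leP 1 r.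
  by rewrite (ler1_powR r1 q1) orbT.
have := @ger_powR _ r _ 0 ((ps - q) / ps) q0.
by rewrite powRr0 => ->//; rewrite r0 ltW.
Qed.

Lemma c_star_ge1 (R : realType) (r ps : R) :
  0 < r -> 1 < ps -> 1 <= c_star r ps.
Proof.
move=> r0 ps1; have := le_c_star _ r ps ps r0 ps1.
by rewrite subrr mul0r powRr0; apply; rewrite lexx andbT; lra.
Qed.

(** These place the base and the argument of the logarithms in [delta_star] on known sides of 1. The
    first comes from [alpha_star >= 2 * r]; eps < 4rm gives the bounds on [kappa] and [b_thr], and
    eps < 4 d sqrt(r) the one on [h_thr]. *)
Lemma threshold_bounds (R : realType) (m r ps eps : R) :
  0 < m -> 0 < r -> 1 < ps -> 0 < eps < sigma_star m r ps ->
  [/\ 4 <= alpha1 r ps eps / r, 0 < kappa m r ps eps < 1,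
      0 < b_thr m r eps < 1 & 1 < h_thr m r ps eps].
Proof.
move=> m0 r0 ps1 /andP[e0]; rewrite /sigma_star !lt_min => /and4P[_ _ e4 e4d].
have c1 := c_star_ge1 _ r ps r0 ps1.
have d0 : 0 < d_star m r ps by rewrite /d_star mulr_gt0//; lra.
have a4 : 4 * r <= alpha1 r ps eps.
  rewrite /alpha1 /alpha_star.
  have : 2 * r <= Num.max (2 * r) (r * (8 * r / eps) `^ (2 / (ps - 1))).
    by rewrite le_max lexx.
  by lra.
split.
- by rewrite ler_pdivlMr.
- have a0 : 0 < 4 * alpha1 r ps eps * m by rewrite mulr_gt0//; lra.
  rewrite /kappa divr_gt0//= ltr_pdivrMr// mul1r (lt_le_trans e4)//.
  by rewrite ler_wpM2r ?ltW//; lra.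
- have rm0 : 0 < 4 * r * m by rewrite mulr_gt0//; lra.
  by rewrite /b_thr divr_gt0//= ltr_pdivrMr// mul1r.
- rewrite /h_thr ltr_pdivlMr ?exprn_gt0// mul1r.
  have : eps ^+ 2 < (4 * d_star m r ps * Num.sqrt r) ^+ 2.
    by rewrite ltr_pXn2r// nnegrE ltW//; apply: lt_trans e4d.
  rewrite 2!exprMn sqr_sqrtr ?(ltW r0)// => /lt_trans; apply.
  have := mulr_gt0 r0 (exprn_gt0 2 d0); lra.
Qed.

Lemma delta_star_gt0 (R : realType) (m r ps eps : R) :
  0 < m -> 0 < r -> 1 < ps -> 0 < eps < sigma_star m r ps ->
  0 < delta_star m r ps eps.
Proof.
move=> m0 r0 ps1 he.
have [a4 /andP[k0 k1] b01 h1] := threshold_bounds _ _ _ _ _ m0 r0 ps1 he.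
have ps0 : 0 < ps by lra.
have a1 : 1 < alpha1 r ps eps / r by lra.
have a2 : alpha2 r ps eps / alpha1 r ps eps = 3 / 2.
  have : alpha1 r ps eps != 0.
    by apply: contraTneq a1 => ->; rewrite mul0r; lra.
  by rewrite /alpha2 /alpha1 => n0; field; apply: contraNneq n0 => ->; rewrite mulr0.
have ra : 0 < r / alpha1 r ps eps < 1.
  by rewrite -[r / _]invf_div invr_gt0 invf_lt1//; lra.
have kl : 0 < 1 - kappa m r ps eps < 1 by apply/andP; split; lra.
have kg : 1 < 1 + kappa m r ps eps by lra.
have ps2 : 0 < (ps - 1) / 2 by lra.
have h32 : 1 < 3 / 2 :> R by lra.
rewrite /delta_star /delta3 /delta4 a2 !lt_min ps2 ps0 !(pmulr_rgt0 _ ps0).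
by rewrite (logb_gt0 _ (h_thr m r ps eps))// !(logb_gt0 _ (alpha1 r ps eps / r))// !logb_gt0_lt1.
Qed.

Lemma delta_star_le (R : realType) (m r ps eps : R) :
  delta_star m r ps eps <= (ps - 1) / 2.
Proof. by rewrite /delta_star /delta3 !ge_min lexx !orbT. Qed.

Lemma sigma_star_gt0 (R : realType) (m r ps : R) :
  0 < m -> 0 < r -> 1 < ps -> 0 < sigma_star m r ps.
Proof.
move=> m0 r0 ps1; have c1 := c_star_ge1 _ r ps r0 ps1.
have d0 : 0 < 4 * d_star m r ps by rewrite /d_star !mulr_gt0//; lra.
by rewrite /sigma_star !lt_min d0 !mulr_gt0// ?sqrtr_gt0//; lra.
Qed.

(** * Pointwise error of the scalar rescaling *)

Lemma powR_tail (R : realType) (r ps eps u s : R) :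
  0 < r -> 1 < ps -> 0 < eps -> alpha1 r ps eps / r <= u ->
  (ps - 1) / 2 <= s -> 1 <= u -> 8 * r / eps <= u `^ s.
Proof.
move=> r0 ps1 e0 au sp u1.
(* [alpha_star] is at least r c^(2/(ps - 1)), and 2/(ps - 1) is the inverse of (ps - 1)/2, the least
   value allowed for [s]. *)
pose c := 8 * r / eps; have c0 : 0 < c by rewrite divr_gt0//; lra.
have cu : c `^ (2 / (ps - 1)) <= u.
  apply: le_trans au; rewrite ler_pdivlMr// /alpha1 /alpha_star -/c mulrC.
  have : r * c `^ (2 / (ps - 1)) <= Num.max (2 * r) (r * c `^ (2 / (ps - 1))).
    by rewrite le_max lexx orbT.
  by have := mulr_gt0 r0 (powR_gt0 (2 / (ps - 1)) c0); lra.
have ps20 : 0 <= (ps - 1) / 2 by lra.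
rewrite -/c (le_trans _ (ler_powR u1 sp))//.
have -> : c = (c `^ (2 / (ps - 1))) `^ ((ps - 1) / 2).
  rewrite -powRrM mulf_div [2 * _]mulrC divff ?powRr1 ?ltW//.
  by rewrite mulf_neq0//; lra.
by rewrite ge0_ler_powR// nnegrE ?powR_ge0//; lra.
Qed.

(** Both u and u^q are nonnegative and at most u^max(1, q), hence so is the distance between them;
    the remaining power u^(p - max(1, q)) absorbs c. *)
Lemma norm_sub_powR_tail (R : realType) (q p c u : R) :
  0 < c -> 1 <= u -> c <= u `^ (p - Num.max 1 q) ->
  `|u - u `^ q| <= c^-1 * u `^ p.
Proof.
move=> c0 u1 cu; have u0 : u != 0 by lra.
have pow_le s : s <= Num.max 1 q -> u `^ s <= c^-1 * u `^ p.
  move=> sq; rewrite ler_pdivlMl// (le_trans _ (_ : u `^ (p - Num.max 1 q) * u `^ Num.max 1 q <= _))//.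
    by rewrite ler_pM// ?powR_ge0 ?(ltW c0)// ler_powR.
  by rewrite -powRD ?subrK// u0 implybT.
have := pow_le 1; rewrite powRr1; last by lra.
rewrite le_max lexx => /(_ isT) L1.
have := pow_le q; rewrite le_max lexx orbT => /(_ isT) L2.
have := powR_ge0 u q; rewrite ler_norml; lra.
Qed.

(** For p < ps the factor u^(p/ps - 1) blows up at 0, so u and its rescaling are bounded separately.
    The threshold 1/h makes r u at most (eps / 8D)^2, and p/ps >= 1/2 turns this into a bound by eps
    / 8D for (r u)^(p/ps). *)
Lemma near0_rescaling (R : realType) (m r ps eps p u : R) :
  0 < m -> 0 < r -> 1 < ps -> 0 < eps < sigma_star m r ps ->
  (ps + 1) / 2 <= p <= ps -> 0 < u <= (h_thr m r ps eps)^-1 ->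
  r * (u + u `^ (p / ps)) <= eps / (4 * m).
Proof.
move=> m0 r0 ps1 /andP[e0]; rewrite /sigma_star !lt_min => /and4P[_ ed _ _].
move=> hp /andP[u0 uh]; have /andP[pl pu] := hp.
have c1 := c_star_ge1 _ r ps r0 ps1.
have ps0 : 0 < ps by lra.
set D := d_star m r ps in ed; have D0 : 0 < D by rewrite /D /d_star mulr_gt0//; lra.
pose q := p / ps; have pE : p = ps * q by rewrite mulrC divfK//; lra.
have [q0 q12] : 0 <= q /\ 2^-1 <= q.
  split; first by rewrite divr_ge0//; lra.
  by rewrite ler_pdivlMr; lra.
pose t := r * u; have t0 : 0 < t by rewrite mulr_gt0.
have te : t <= (eps / (8 * D)) ^+ 2.
  rewrite /t (le_trans (ler_wpM2l (ltW r0) uh))// /h_thr -/D le_eqVlt.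
  by apply/orP; left; apply/eqP; field; rewrite !lt0r_neq0.
have e1 : 0 <= eps / (8 * D) <= 1.
  by rewrite divr_ge0/= ?ler_pdivrMr; lra.
have t1 : 0 < t <= 1 by rewrite t0 (le_trans te)// expr_le1//; lra.
have st : t `^ 2^-1 <= eps / (8 * D).
  have /andP[e10 _] := e1.
  by rewrite powR12_sqrt ?(ltW t0)// -(ger0_norm e10) -sqrtr_sqr ler_wsqrtr.
have tq : t `^ q <= eps / (8 * D) by apply: le_trans st; apply: ger_powR.
have tt : t <= eps / (8 * D).
  by apply: le_trans st; apply: ger1_powR => //; lra.
have uq : r * u `^ q <= c_star r ps * (eps / (8 * D)).
  (* Passing from u to t = r u leaves the power of r that [c_star] bounds. *)
  have -> : r * u `^ q = r `^ ((ps - p) / ps) * t `^ q.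
    rewrite powRM ?ltW// mulrA -powRD ?(lt0r_neq0 r0) ?implybT//.
    by rewrite -mulrDl subrK divff ?lt0r_neq0// powRr1 ?ltW.
  by rewrite ler_pM ?powR_ge0// le_c_star.
rewrite mulrDr -/t -/q (le_trans (lerD tt uq))//.
(* The factor c_star + 1 cancels against the one in D. *)
have -> : eps / (8 * D) + c_star r ps * (eps / (8 * D)) = eps / (8 * (m + 1)).
  by rewrite /D /d_star; field; rewrite !lt0r_neq0//; lra.
by rewrite ler_pM2l// lef_pV2 ?posrE//; lra.
Qed.

(* Here u = t / r. The first summand is the error for t <= alpha1, where t is
   either close to 0 or rescaled by a factor within kappa of 1; the second one is
   the error for t > alpha1. *)
Lemma rescaling_error (R : realType) (m r ps eps p u : R) :
  0 < m -> 0 < r -> 1 < ps -> 0 < eps < sigma_star m r ps ->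
  ps - delta_star m r ps eps < p < ps + delta_star m r ps eps -> 0 <= u ->
  r * `|u - u `^ (p / ps)| <= eps / (4 * m) + eps / 8 * u `^ p.
Proof.
move=> m0 r0 ps1 he /andP[pl pu] u0; have [e0 _] := andP he.
have [a4 /andP[k0 k1] b01 h1] := threshold_bounds _ _ _ _ _ m0 r0 ps1 he.
have ps0 : 0 < ps by lra.
pose q := p / ps; have pE : p = ps * q by rewrite mulrC divfK//; lra.
have pd := delta_star_le _ m r ps eps.
have [u_tail|u_le] := leP (alpha1 r ps eps / r) u.
  have u1 : 1 <= u by lra.
  have up := powR_ge0 u p.
  have tail : `|u - u `^ q| <= (8 * r / eps)^-1 * u `^ p.
    apply: norm_sub_powR_tail => //; first by rewrite divr_gt0//; lra.
    (* The exponent p - max(1, q) is at least (ps - 1)/2: for q >= 1 it is p - q = q (ps - 1), and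
       for q < 1 it is p - 1 with p > (ps + 1)/2. *)
    apply: (powR_tail _ _ ps) => //; rewrite maxEle; case: ifPn => [q1|]; last by lra.
    have : (q - 1) * (ps - 1) >= 0 by rewrite mulr_ge0//; lra.
    by rewrite pE; lra.
  apply: (le_trans (ler_wpM2l (ltW r0) tail)).
  have -> : r * ((8 * r / eps)^-1 * u `^ p) = eps / 8 * u `^ p.
    by field; apply/andP; split; lra.
  by rewrite lerDr divr_ge0//; lra.
have up : 0 <= eps / 8 * u `^ p by rewrite mulr_ge0 ?powR_ge0//; lra.
suff : r * `|u - u `^ q| <= eps / (4 * m) by rewrite -/q; lra.
have em0 : 0 < eps / (4 * m) by rewrite divr_gt0//; lra.
have [->|u_neq0] := eqVneq u 0.
  by rewrite powR0 ?subrr ?normr0 ?mulr0 ?ltW//; nra.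
have {}u0 : 0 < u by rewrite lt0r u_neq0.
(* A relative error of at most kappa suffices: t = r u stays below alpha1, and alpha1 kappa = eps /
   (4m). *)
have far0 : `|1 - u `^ (q - 1)| <= kappa m r ps eps ->
    r * `|u - u `^ q| <= eps / (4 * m).
  move=> uk; rewrite -(mulr_powRB1 (ltW u0)); last by nra.
  rewrite -{1}[u]mulr1 -mulrBr normrM (gtr0_norm u0).
  have -> : eps / (4 * m) = r * (alpha1 r ps eps / r * kappa m r ps eps).
    rewrite /kappa; field; rewrite !lt0r_neq0//.
    by move: a4; rewrite ler_pdivlMr//; lra.
  by rewrite ler_pM2l// ler_pM ?(ltW u_le)// ltW.
move: pl pu; rewrite pE /delta_star /delta3 /delta4.
have logq x : ps * q < ps + ps * x -> q - 1 < x.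
  by rewrite -{2}[ps]mulr1 -mulrDr ltr_pM2l//; lra.
have logq' x : ps - ps * x < ps * q -> 1 - q < x.
  by rewrite -{1}[ps]mulr1 -mulrBr ltr_pM2l//; lra.
(* For q >= 1 ([delta4]), u^q <= u near 0, so u <= b already gives the bound. Above b, u^(q - 1)
   lies between its values at b and alpha1 / r, which the logarithms keep within kappa of 1. *)
have [q1|q1] := leP 1 q.
  move=> _; rewrite -ltrBlDl !lt_min !ltrBlDl => /andP[_ /and4P[_ /logq bq /logq aq _]].
  have [ub|ub] := leP u (b_thr m r eps).
    have u01 : 0 < u <= 1 by rewrite u0; lra.
    have uq := ge1r_powR u01 q1.
    rewrite ger0_norm ?subr_ge0//.
    have -> : eps / (4 * m) = r * b_thr m r eps.
      by rewrite /b_thr; field; rewrite !lt0r_neq0.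
    by rewrite ler_pM2l//; have := powR_ge0 u q; lra.
  apply: far0; have q10 : 0 <= q - 1 by lra.
  have B : 1 - kappa m r ps eps <= u `^ (q - 1).
    apply: (le_trans (powR_ge_of_le_logb _ _ _ _ b01 _ (ltW bq))); first by lra.
    by rewrite ge0_ler_powR// ?nnegrE; lra.
  have A : u `^ (q - 1) <= 1 + kappa m r ps eps.
    apply: (le_trans _ (powR_le_of_le_logb _ _ _ _ _ _ (ltW aq))); [|lra|lra].
    by rewrite ge0_ler_powR// ?nnegrE; lra.
  by rewrite ler_norml; lra.
(* For q < 1 ([delta3]), the cutoff near 0 is 1/h. Beyond it 1/u lies in [r / alpha1, h], and u^(q -
   1) is an increasing function of 1/u. *)
move=> + _; rewrite ltrBlDr -ltrBlDl !lt_min !ltrBlDl -!ltrBlDr.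
move=> /andP[/and3P[/logq' aq /logq' hq dq] _].
have [uh|uh] := leP u (h_thr m r ps eps)^-1.
  have hp : (ps + 1) / 2 <= p <= ps by rewrite pE; apply/andP; split; nra.
  have := near0_rescaling _ m r ps eps p u m0 r0 ps1 he hp.
  rewrite u0 uh -/q => /(_ isT); apply: le_trans.
  by rewrite ler_pM2l// ler_norml; have := powR_ge0 u q; lra.
apply: far0; have q10 : 0 <= 1 - q by lra.
have -> : u `^ (q - 1) = u^-1 `^ (1 - q).
  by rewrite -(powR_inv1 (ltW u0)) -powRrM mulN1r opprB.
have ui0 : 0 < u^-1 by rewrite invr_gt0.
have uih : u^-1 <= h_thr m r ps eps by rewrite invf_ple ?posrE ?ltW//; lra.
have uia : r / alpha1 r ps eps <= u^-1.
  by rewrite -[r / _]invf_div lef_pV2 ?posrE ?ltW//; lra.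
have ra : 0 < r / alpha1 r ps eps < 1.
  by rewrite -[r / _]invf_div invr_gt0 invf_lt1//; lra.
have B : 1 - kappa m r ps eps <= u^-1 `^ (1 - q).
  apply: (le_trans (powR_ge_of_le_logb _ _ _ _ ra _ (ltW aq))); first by lra.
  by rewrite ge0_ler_powR// ?nnegrE; lra.
have A : u^-1 `^ (1 - q) <= 1 + kappa m r ps eps.
  apply: (le_trans _ (powR_le_of_le_logb _ _ _ _ _ _ (ltW hq))); [|lra|lra].
  by rewrite ge0_ler_powR// ?nnegrE; lra.
by rewrite ler_norml; lra.
Qed.

(** * The radial rescaling on X *)

Definition radial_pow {R : realType} {X : normedModType R} (r q : R) (v : X) : X :=
  (`|v| / r) `^ (q - 1) *: v.

Lemma norm_radial_pow (R : realType) (X : normedModType R) (r q : R) (v : X) :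
  0 < r -> 0 < q -> `|radial_pow r q v| = r * (`|v| / r) `^ q.
Proof.
move=> r0 q0; have v0 : 0 <= `|v| / r by rewrite divr_ge0// ltW.
rewrite normrZ ger0_norm ?powR_ge0// -(mulr_powRB1 v0 q0).
by field; rewrite lt0r_neq0.
Qed.

Lemma norm_sub_radial_pow (R : realType) (X : normedModType R) (r q : R) (v : X) :
  0 < r -> 0 < q -> `|v - radial_pow r q v| = r * `| (`|v| / r) - (`|v| / r) `^ q |.
Proof.
move=> r0 q0; have v0 : 0 <= `|v| / r by rewrite divr_ge0// ltW.
rewrite -{1}[v]scale1r -scalerBl normrZ -(mulr_powRB1 v0 q0).
rewrite -[X in `|X - _ * _|]mulr1 -mulrBr normrM (ger0_norm v0).
by field; rewrite lt0r_neq0.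
Qed.

Lemma continuous_powR_gt0 (R : realType) (s a : R) :
  0 < a -> {for a, continuous (fun x : R => x `^ s)}.
Proof.
move=> a0; apply: differentiable_continuous; apply/derivable1_diffP.
by apply: derivable_powR; rewrite in_itv/= a0.
Qed.

(** Away from 0 this is a product of continuous maps. At 0 the scalar factor is unbounded when q <
    1, but the norm r (|v| / r)^q still tends to 0. Continuity makes the rescaled function
    mu-measurable. *)
Lemma continuous_radial_pow (R : realType) (X : normedModType R) (r q : R) :
  0 < r -> 0 < q -> continuous (@radial_pow R X r q).
Proof.
move=> r0 q0 v; have [->|v0] := eqVneq v 0.
  rewrite /continuous_at [X in _ --> X](_ : _ = 0); last by rewrite /radial_pow scaler0.
  apply/cvgr0Pnorm_lt => e e0; have er : 0 < e / r by rewrite divr_gt0.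
  near=> u; rewrite norm_radial_pow//.
  suff : (`|u| / r) `^ q < e / r by rewrite ltr_pdivlMr// mulrC.
  have -> : e / r = ((e / r) `^ q^-1) `^ q.
    by rewrite -powRrM mulVf ?lt0r_neq0// powRr1// ltW.
  apply: gt0_ltr_powR; rewrite ?nnegrE ?powR_ge0//; first by rewrite divr_ge0// ltW.
  rewrite ltr_pdivrMr//; near: u; apply: nbhs0_lt.
  exact: mulr_gt0 (powR_gt0 _ er) r0.
apply: (cvgZ (s := fun u : X => (`|u| / r) `^ (q - 1)) (f := id)) => //.
apply: (@continuous_comp _ _ _ (fun u : X => `|u| / r) (fun x : R => x `^ (q - 1))).
  by apply: (cvgMr_tmp (f := fun u : X => `|u|)); apply: (cvg_norm (f := id)).
by apply: continuous_powR_gt0; rewrite divr_gt0// normr_gt0.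
Unshelve. all: by end_near. Qed.

(** * Measurability and integral bounds *)

Section bochner.
Context {R : realType} {d : measure_display} {T : measurableType d}
  {X : normedModType R} {mu : {measure set T -> \bar R}}.

Lemma measurable_comp_simple_fun d' (U : measurableType d') (g : X -> U) (s : T -> X) :
  simple_fun s -> measurable_fun setT (g \o s).
Proof.
move=> [fs ms] _ Y mY; rewrite setTI.
have -> : (g \o s) @^-1` Y = \bigcup_(c in range s `&` g @^-1` Y) s @^-1` [set c].
  apply/seteqP; split => [t Yt|t [c [_ Yc] /= stc]]; last by rewrite /= stc.
  by exists (s t) => //; split => //; exists t.
by apply: fin_bigcup_measurable => // ; exact: finite_setIl.
Qed.

Lemma mu_measurable_comp (g : X -> X) (x : T -> X) :
  continuous g -> mu_measurable mu x -> mu_measurable mu (g \o x).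
Proof.
move=> cg [s ss sx]; exists (fun n => g \o s n) => [n|].
  exact: (simple_fun_comp2 (fun u _ => g u) (ss n) (ss n)).
by apply: filterS sx => t xt; apply: continuous_cvg => //; exact: cg.
Qed.

(* mu need not be complete, so t |-> |x t| may fail to be measurable; it becomes
   so after changing x on the negligible set where the simple functions do not
   converge. *)
Lemma mmfun_measurable_norm (x : mmfun X mu) : exists y : mmfun X mu,
  (x : T -> X) = y %[ae mu] /\ measurable_fun setT (fun t => `|y t|).
Proof.
have := valP x; rewrite inE => -[s ss [N [mN N0 sN]]].
have mD := measurableC mN.
have sx t : (~` N) t -> s ^~ t @ \oo --> x t.
  by move=> Nt; apply: contrapT => /sN.
(* Off N the norm is a pointwise limit of the measurable functions |s_n|. *)
have mx : measurable_fun setT ((fun t => `|x t|) \_ (~` N)).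
  apply/(measurable_restrictT _ mD).1.
  apply: (@measurable_realfun.measurable_fun_cvg _ _ _ _ (fun n t => `|s n t|)).
    by move=> n; apply: measurable_funTS; exact: measurable_comp_simple_fun.
  by move=> t Dt; apply: cvg_norm; exact: sx.
pose y t : X := \1_(~` N) t *: x t.
have yx t : (~` N) t -> y t = x t.
  by move=> Dt; rewrite /y indicE mem_set// scale1r.
have ym : y \in mu_meas mu.
  rewrite inE; exists s; first exact: ss. exists N; split => // t /= syt.
  by apply: contrapT => Nt; apply: syt; rewrite yx//; exact: sx.
exists (MMFun ym); split.
  exists N; split => // t /= xyt; apply: contrapT => Nt; apply: xyt => _.
  by rewrite yx.
move: mx; rewrite patch_indic; apply: eq_measurable_fun => t _ /=.
by rewrite /y normrZ ger0_norm ?indicE// mulrC.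
Qed.

Lemma Lnorm_le_powR (f : T -> \bar R) (p r : R) : 0 < p -> 0 <= r ->
  ('N[mu]_(p%:E)[f] <= r%:E)%E = (\int[mu]_t (`|f t| `^ p) <= (r `^ p)%:E)%E.
Proof.
move=> p0 r0; rewrite -poweR_Lnorm ?lt0r_neq0//.
have N0 := Lnorm_ge0 mu p%:E f.
apply/idP/idP => h.
  rewrite -poweR_EFin; apply: gt0_ler_poweR => //; first exact: ltW.
    by rewrite in_itv/= N0 leey.
  by rewrite in_itv/= lee_fin r0 leey.
have := @gt0_ler_poweR R p^-1 _ _ _ _ _ h; rewrite -poweRrM mulfV ?lt0r_neq0//.
rewrite poweRe1// poweR_EFin -powRrM mulfV ?lt0r_neq0// powRr1//; apply.
- by rewrite invr_ge0 ltW.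
- by rewrite in_itv/= poweR_ge0 leey.
- by rewrite in_itv/= lee_fin powR_ge0 leey.
Qed.


(** Integrates the pointwise error bound, where u is the p-th power of |x| / r. *)
Lemma integral_le_affine (u h : T -> R) (a b : R) : 0 <= a -> 0 <= b ->
  (forall t, 0 <= u t) -> (forall t, 0 <= h t <= a + b * u t) ->
  measurable_fun setT u -> measurable_fun setT h ->
  (\int[mu]_t (h t)%:E <= a%:E * mu setT + b%:E * \int[mu]_t (u t)%:E)%E.
Proof.
move=> a0 b0 u0 hu mu_ mh.
have mbu : measurable_fun setT (fun t => b * u t) by exact: measurable_funM.
apply: (le_trans (y := (\int[mu]_t (a%:E + (b * u t)%:E))%E)).
  apply: ge0_le_integral => //=.
  - by move=> t _; rewrite lee_fin; have /andP[] := hu t.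
  - exact/measurable_EFinP.
  - by apply/measurable_EFinP; exact: measurable_funD.
  - by move=> t _; rewrite -EFinD lee_fin; have /andP[] := hu t.
rewrite ge0_integralD//=; last 2 first.
- by move=> t _; rewrite lee_fin mulr_ge0.
- exact/measurable_EFinP.
rewrite (integral_cst mu measurableT a%:E) leeD2l//.
under eq_integral do rewrite EFinM.
by rewrite ge0_integralZl_EFin//; [move=> t _; rewrite lee_fin|exact/measurable_EFinP].
Qed.
End bochner.

(** * The inclusion of balls *)

Theorem theorem4p1 (R : realType) (d : measure_display)
    (Omega : measurableType d) (mu : {finite_measure set Omega -> \bar R})
    (X : completeNormedModType R) (r pstar : R)
    (mu_gt0 : (0 < mu [set: Omega])%E) (sepX : separable_space X)
    (r_gt0 : 0 < r) (pstar_gt1 : 1 < pstar) :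
  let m := fine (mu [set: Omega]) in
  0 < sigma_star m r pstar /\
  forall eps : R, 0 < eps < sigma_star m r pstar ->
    let delta := delta_star m r pstar eps in
    0 < delta <= (pstar - 1) / 2 /\
    forall p : R, pstar - delta < p < pstar + delta ->
      Bochner_ball X mu p r `<=`
      [set y + z | y in Bochner_ball X mu pstar r
                 & z in [set eps *: u | u in Bochner_ball X mu 1 1]].
Proof.
move=> m; have mfin : mu [set: Omega] \is a fin_num by exact: fin_num_measure.
have mE : mu [set: Omega] = m%:E by rewrite fineK.
have m0 : 0 < m by rewrite -lte_fin -mE.
split; first exact: sigma_star_gt0.
move=> eps he delta; have [e0 _] := andP he.
have dle : delta <= (pstar - 1) / 2 by exact: delta_star_le.
split; first by rewrite dle andbT delta_star_gt0.
move=> p hp xx [_ hxx]; have /andP[pl pu] := hp.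
have p0 : 0 < p by lra.
have ps0 : 0 < pstar by lra.
pose q := p / pstar; have q0 : 0 < q by rewrite divr_gt0.
(* Ball membership depends only on the class, so a representative with measurable norm may be
   used. *)
have [x [xxE mx]] := mmfun_measurable_norm (repr xx).
have {}xxE : xx = (\pi_(L0 X mu) x)%qT by rewrite -[LHS]reprK; apply/L0_eqP.
rewrite {}xxE Bochner_norm_pi in hxx *.
have ym : radial_pow r q \o x \in mu_meas mu.
  rewrite inE; apply: mu_measurable_comp; first exact: continuous_radial_pow.
  by have := valP x; rewrite inE.
pose y : mmfun X mu := MMFun ym.
pose v t := `|x t| / r; have v0 t : 0 <= v t by rewrite divr_ge0// ltW.
have mv : measurable_fun setT v by exact: measurable_funM.
have mpow s : measurable_fun setT (fun t => v t `^ s).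
  exact: (measurableT_comp (measurable_powR s)).
(* Since |x|^p = r^p v^p and |y|^pstar = r^pstar v^p, the cases s = p and s = pstar reduce both ball
   conditions to the same one: the integral of v^p is at most 1. *)
have intv s : (\int[mu]_t (r `^ s * v t `^ p)%:E <= (r `^ s)%:E)%E =
    (\int[mu]_t (v t `^ p)%:E <= 1)%E.
  under eq_integral do rewrite EFinM.
  rewrite ge0_integralZl_EFin ?powR_ge0//=; last 2 first.
  - by move=> t _; rewrite lee_fin powR_ge0.
  - exact/measurable_EFinP.
  by rewrite -[X in (_ <= X)%E]mule1 lee_pmul2l// ?lte_fin ?powR_gt0.
have vp1 : (\int[mu]_t (v t `^ p)%:E <= 1)%E.
  rewrite -(intv p); move: hxx; rewrite (Lnorm_le_powR _ _ _ p0 (ltW r_gt0)).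
  congr (_ <= _)%E; apply: eq_integral => t _ /=.
  by rewrite normr_id -powRM ?(ltW r_gt0)// /v [r * _]mulrC divfK// lt0r_neq0.
have yball : Bochner_ball X mu pstar r (\pi_(L0 X mu) y)%qT.
  suff h : (Bochner_norm pstar (\pi_(L0 X mu) y)%qT <= r%:E)%E.
    by split => //; apply: le_lt_trans h _; rewrite ltry.
  rewrite Bochner_norm_pi (Lnorm_le_powR _ _ _ ps0 (ltW r_gt0)).
  move: vp1; rewrite -(intv pstar); congr (_ <= _)%E; apply: eq_integral => t _ /=.
  rewrite normr_id norm_radial_pow// powRM ?powR_ge0 ?(ltW r_gt0)// -/(v t).
  by rewrite -powRrM /q divfK// lt0r_neq0.
exists (\pi_(L0 X mu) y)%qT => //.
exists (eps *: (eps^-1 *: (\pi_(L0 X mu) (x - y))%qT)); last first.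
  by rewrite scalerA divff ?lt0r_neq0// scale1r L0_piD addrC subrK.
exists (eps^-1 *: (\pi_(L0 X mu) (x - y))%qT) => //.
suff h : (Bochner_norm 1 (eps^-1 *: (\pi_(L0 X mu) (x - y)%R)%qT)%R <= 1%:E)%E.
  by split => //; apply: le_lt_trans h _; rewrite ltry.
rewrite L0_piZ Bochner_norm_pi Lnorm1.
pose h t := eps^-1 * (r * `|v t - v t `^ q|).
have -> : (\int[mu]_t `|(EFin \o (fun t => `|(eps^-1 *: (x - y) : mmfun X mu)%R t|%R)) t| =
    \int[mu]_t (h t)%:E)%E.
  apply: eq_integral => t _ /=; rewrite normr_id.
  rewrite (_ : (_ : Omega -> X) t = eps^-1 *: (x t - radial_pow r q (x t)))//.
  by rewrite normrZ norm_sub_radial_pow// ger0_norm// invr_ge0 ltW.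
(* The coefficients are those of [rescaling_error] divided by eps; after integration they give at
   most 1/4 + 1/8 <= 1. *)
apply: (le_trans (integral_le_affine (fun t => v t `^ p) h (4 * m)^-1 8^-1 _ _ _ _ _ _)) => //.
- by rewrite invr_ge0 mulr_ge0 ?ltW.
- by move=> t; exact: powR_ge0.
- move=> t; have := rescaling_error _ m r pstar eps p (v t) m0 r_gt0 pstar_gt1 he hp (v0 t).
  rewrite -/q /h => le; apply/andP; split.
    by rewrite mulr_ge0 ?invr_ge0 ?(ltW e0)// mulr_ge0// ltW.
  rewrite ler_pdivrMl// (le_trans le)// le_eqVlt; apply/orP; left; apply/eqP.
  by field; rewrite lt0r_neq0.
- apply: measurable_funM => //; apply: measurable_funM => //.
  by apply: measurableT_comp => //; exact: measurable_funB.
have h1 : (8^-1%:E * \int[mu]_t (v t `^ p)%:E <= 8^-1%:E)%E.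
  by rewrite -[leRHS]mule1 lee_pmul2l// lte_fin.
rewrite [X in (_ * X)%E]mE (le_trans (leeD2l _ h1))// -EFinM -EFinD lee_fin.
rewrite invfM -mulrA mulVf ?lt0r_neq0//; lra.
Qed.
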